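(* Let $\mathcal{G}^C=(\mathcal{V}^C,\mathcal{E}^C)$ be an admissible cluster-DAG. Let $\mathcal{G}^m_{\min}$ be its corresponding minimal compatible graph and let $\mathcal{G}^{m,C}_{\mathrm{u}}$ be its corresponding unfolded graph. Let $\mathcal{X}^C,\mathcal{Y}^C,\mathcal{Z}^C$ be pairwise disjoint subsets of nodes of $\mathcal{G}^C$, and let $\mathcal{A}^C$ and $\mathcal{B}^C$ be subsets of nodes of $\mathcal{G}^C$. Then the following properties are equivalent: 1. It is not the case that, for every $\mathcal{G}^m\in\mathcal{C}(\mathcal{G}^C)$, $\mathcal{X}^m$ and $\mathcal{Y}^m$ are d-separated by $\mathcal{Z}^m$ in the mutilated graph $\mathcal{G}^m_{\overline{\mathcal{A}^m}\,\underline{\mathcal{B}^m}}$; that is, there exists $\mathcal{G}^m\in\mathcal{C}(\mathcal{G}^C)$ such that $\mathcal{X}^m$ and $\mathcal{Y}^m$ are not d-separated by $\mathcal{Z}^m$ in $\mathcal{G}^m_{\overline{\mathcal{A}^m}\,\underline{\mathcal{B}^m}}$. 2. The mutilated graph $(\mathcal{G}^{m,C}_{\mathrm{u}})_{\overline{\mathcal{A}^m}\,\underline{\mathcal{B}^m}}$ contains a structure of interest $\sigma^m$ that connects $\mathcal{X}^m$ and $\mathcal{Y}^m$ under $\mathcal{Z}^m$ such that $\mathcal{G}^m_{\min}\cup\sigma^m$ is acyclic.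
   Context: A mixed graph is a finite graph with directed edges ($\rightarrow$) and bidirected edges ($\leftrightarrow$); both kinds may be present between the same two vertices. It is acyclic if it has no directed cycle. An ADMG is an acyclic mixed graph all of whose edges join distinct vertices. Unions of graphs are taken on vertices and edges. Mutilated graph: $\mathcal{G}_{\overline{\mathcal{A}}\,\underline{\mathcal{B}}}$ is obtained from $\mathcal{G}$ by removing all edges with an arrowhead into a vertex of $\mathcal{A}$ (directed edges into $\mathcal{A}$ and bidirected edges with an endpoint in $\mathcal{A}$) and all edges with a tail at a vertex of $\mathcal{B}$ (directed edges out of $\mathcal{B}$). Cluster-DAG: a finite mixed graph $\mathcal{G}^C=(\mathcal{V}^C,(\mathcal{E}^C_D,\mathcal{E}^C_B))$ whose nodes are pairwise disjoint non-empty clusters of variables; a cluster $V$ of size $\#V\ge 1$ is $V=\{V_1,\dots,V_{\#V}\}$. Directed cycles in $\mathcal{G}^C$ and self-loops of both types (directed and bidirected) are allowed. Compatible micro graph: an ADMG $\mathcal{G}^m=(\mathcal{V}^m,(\mathcal{E}^m_D,\mathcal{E}^m_B))$ with $\mathcal{V}^m=\bigcup_{V\in\mathcal{V}^C}\{V_1,\dots,V_{\#V}\}$ such that: for all distinct clusters $A,B$, $A\rightarrow B\in\mathcal{E}^C_D$ iff there are $i,j$ with $A_i\rightarrow B_j\in\mathcal{E}^m_D$; for all distinct clusters $A,B$, $A\leftrightarrow B\in\mathcal{E}^C_B$ iff there are $i,j$ with $A_i\leftrightarrow B_j\in\mathcal{E}^m_B$; for each cluster $A$, the directed self-loop on $A$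 is in $\mathcal{E}^C_D$ iff there are distinct $i,j$ with $A_i\rightarrow A_j\in\mathcal{E}^m_D$; for each cluster $A$, the bidirected self-loop on $A$ is in $\mathcal{E}^C_B$ iff there are distinct $i,j$ with $A_i\leftrightarrow A_j\in\mathcal{E}^m_B$. $\mathcal{C}(\mathcal{G}^C)$ is the set of all micro graphs compatible with $\mathcal{G}^C$. $\mathcal{G}^C$ is admissible if $\mathcal{C}(\mathcal{G}^C)\ne\emptyset$. For a set $\mathcal{S}^C$ of clusters, $\mathcal{S}^m$ is the set of all variables belonging to the clusters of $\mathcal{S}^C$. Minimal compatible graph $\mathcal{G}^m_{\min}=(\mathcal{V}_{\min},\mathcal{E}_{\min})$: $\mathcal{V}_{\min}=\bigcup_{V\in\mathcal{V}^C}\{V_1,\dots,V_{\#V}\}$, with edges: (1) for each bidirected edge $U\leftrightarrow V$ of $\mathcal{G}^C$ (including $U=V$), all $U_i\leftrightarrow V_j$ with $U_i\neq V_j$; (2) for each directed self-loop on $V$, all $V_i\rightarrow V_j$ with $i<j$; (3) for each directed edge $U\rightarrow V$ with $U\ne V$, the edge $U_1\rightarrow V_{\#V}$. Unfolded graph $\mathcal{G}^{m,C}_{\mathrm{u}}$: the mixed graph with vertex set $\mathcal{V}_{\min}$ and edge set $\mathcal{E}_{\min}\cup\mathcal{E}_{\text{to choose}}$, where $\mathcal{E}_{\text{to choose}}$ is the set of all directed edges $U_i\rightarrow V_j$ such that $U\rightarrow V$ is an edge of $\mathcal{G}^C$ and adding $U_i\rightarrow V_j$ to $\mathcal{G}^m_{\min}$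 does not create a directed cycle. d-separation: A path is a sequence of distinct vertices joined by consecutive edges. An interior vertex is a collider on it if both adjacent path edges have an arrowhead at it; all other vertices are non-colliders. A path is active given $\mathcal{Z}$ if every collider on it is in $\mathcal{Z}$ or has a descendant in $\mathcal{Z}$, and no non-collider on it is in $\mathcal{Z}$ (descendants are taken in the graph in which d-separation is considered). $\mathcal{X}$ and $\mathcal{Y}$ are d-separated by $\mathcal{Z}$ if no path between a vertex of $\mathcal{X}$ and a vertex of $\mathcal{Y}$ is active given $\mathcal{Z}$. Structure of interest: an ADMG with a single connected component in which each node $V$ has at most one outgoing arrow (directed edge with tail at $V$), or has two outgoing arrows but no incoming arrow (no directed or bidirected edge with an arrowhead at $V$). $\mathrm{Root}(\sigma)$ is the set of vertices of $\sigma$ with no child in $\sigma$. A structure of interest $\sigma$ connects $\mathcal{X}$ and $\mathcal{Y}$ under $\mathcal{Z}$ in a mixed graph $\mathcal{G}$ if: $\sigma\subseteq\mathcal{G}$ (subgraph); $\sigma$ contains a vertex of $\mathcal{X}$ and a vertex of $\mathcal{Y}$; $\mathrm{Root}(\sigma)\subseteq\mathcal{Z}\cup\mathcal{X}\cup\mathcal{Y}$; and no vertex of $\sigma$ outside $\mathrm{Root}(\sigma)$ belongs to $\mathcal{Z}$. *)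

(* Defs.v *)
From HB Require Import structures.
From mathcomp Require Import all_boot.

Set Implicit Arguments.
Unset Strict Implicit.
Unset Printing Implicit Defensive.

(* Finite mixed graphs.  The vertex set is explicit because subgraphs of a
   graph on T need not contain all of T.  Each relation may relate a vertex to
   itself (self-loops), and both may hold of the same pair of vertices. *)
Record mgraph (T : finType) := MGraph {
  verts : {set T};
  dir : rel T;
  bid : rel T;
  dir_verts : forall x y, dir x y -> (x \in verts) && (y \in verts);
  bid_verts : forall x y, bid x y -> (x \in verts) && (y \in verts);
  bid_sym : symmetric bid
}.

Section Acyclicity.
Variable T : finType.

Definition acyclic (e : rel T) : Prop := forall c : seq T, ucycle e c -> c = [::].

Definition acyclicb (e : rel T) : bool :=
  [forall x, forall y, e x y ==> ~~ connect e y x].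

Lemma acyclicP (e : rel T) : reflect (acyclic e) (acyclicb e).
Proof.
apply: (iffP idP) => [/forallP acyc [//|x p] /andP[cyc _] | acyc].
  move: cyc; case: p => [|y p] /=.
    by rewrite andbT => exx; move: (implyP (forallP (acyc x) x) exx); rewrite connect0.
  move=> /andP[exy yp]; have /negP[] := implyP (forallP (acyc x) y) exy.
  by apply/connectP; exists (rcons p x); rewrite ?last_rcons.
apply/forallP => x; apply/forallP => y; apply/implyP => exy; apply/negP.
case/connectP => p yp xE; move: exy; rewrite xE.
case/shortenP: yp => q yq uq _ exy.
suff /acyc : ucycle e (y :: q) by [].
by rewrite /ucycle uq andbT /= rcons_path yq.
Qed.

End Acyclicity.

Section MixedGraphs.
Variable T : finType.
Implicit Types (G H : mgraph T) (A B X Y Z : {set T}).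

Definition admg G : Prop :=
  [/\ acyclic (dir G), irreflexive (dir G) & irreflexive (bid G)].

Definition subgraph H G : Prop :=
  [/\ verts H \subset verts G, subrel (dir H) (dir G) & subrel (bid H) (bid G)].

Fact union_dir_verts G H x y : dir G x y || dir H x y ->
  (x \in verts G :|: verts H) && (y \in verts G :|: verts H).
Proof. by rewrite !inE; case/orP => /dir_verts/andP[-> ->]; rewrite ?orbT. Qed.

Fact union_bid_verts G H x y : bid G x y || bid H x y ->
  (x \in verts G :|: verts H) && (y \in verts G :|: verts H).
Proof. by rewrite !inE; case/orP => /bid_verts/andP[-> ->]; rewrite ?orbT. Qed.

Fact union_bid_sym G H : symmetric (fun x y => bid G x y || bid H x y).
Proof. by move=> x y; rewrite bid_sym [bid H x y]bid_sym. Qed.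

Definition union G H : mgraph T :=
  MGraph (@union_dir_verts G H) (@union_bid_verts G H) (@union_bid_sym G H).

Fact mutilate_dir_verts G A B x y : [&& dir G x y, y \notin A & x \notin B] ->
  (x \in verts G) && (y \in verts G).
Proof. by case/and3P => /dir_verts. Qed.

Fact mutilate_bid_verts G A x y : [&& bid G x y, x \notin A & y \notin A] ->
  (x \in verts G) && (y \in verts G).
Proof. by case/and3P => /bid_verts. Qed.

Fact mutilate_bid_sym G A :
  symmetric (fun x y => [&& bid G x y, x \notin A & y \notin A]).
Proof. by move=> x y; rewrite bid_sym [(x \notin A) && _]andbC. Qed.

(* Arrowheads into A and tails out of B are removed. *)
Definition mutilate G A B : mgraph T :=
  MGraph (@mutilate_dir_verts G A B) (@mutilate_bid_verts G A)
         (@mutilate_bid_sym G A).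

(* Two vertices may be joined by several edges, so a path records the edges it
   takes: it is a first vertex x with a sequence s of pairs
   (edge taken, vertex reached). *)
Inductive edge_kind := Fwd | Bwd | Bidir.

Definition joins G (k : edge_kind) (x y : T) : bool :=
  match k with
  | Fwd => dir G x y
  | Bwd => dir G y x
  | Bidir => bid G x y
  end.

Fixpoint walk G (x : T) (s : seq (edge_kind * T)) : bool :=
  if s is (k, y) :: s' then joins G k x y && walk G y s' else true.

Definition mpath G (x : T) (s : seq (edge_kind * T)) : bool :=
  [&& x \in verts G, walk G x s & uniq (x :: unzip2 s)].

Definition head_at_end (k : edge_kind) : bool := if k is Bwd then false else true.
Definition head_at_start (k : edge_kind) : bool := if k is Fwd then false else true.

(* v is in Z or has a descendant in Z, as connect is reflexive *)
Definition opened G Z (v : T) : Prop := exists2 z, z \in Z & connect (dir G) v z.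

(* The two endpoints are non-colliders; every interior vertex v sits between
   an edge k1 (arriving at v) and an edge k2 (leaving v). *)
Definition active G Z (x : T) (s : seq (edge_kind * T)) : Prop :=
  [/\ x \notin Z,
      last x (unzip2 s) \notin Z &
      forall s1 k1 v k2 w s2, s = s1 ++ (k1, v) :: (k2, w) :: s2 ->
        if head_at_end k1 && head_at_start k2 then opened G Z v
        else v \notin Z].

Definition dsep G X Y Z : Prop :=
  forall x s, x \in X -> last x (unzip2 s) \in Y -> mpath G x s ->
    ~ active G Z x s.

Definition adjacent G : rel T := [rel x y | [|| dir G x y, dir G y x | bid G x y]].

Definition children G (v : T) : {set T} := [set w | dir G v w].

Definition structure_of_interest G : Prop :=
  [/\ admg G,
      n_comp (adjacent G) (verts G) = 1 &
      forall v, v \in verts G ->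
        #|children G v| <= 1 \/
        #|children G v| = 2 /\ (forall u, ~~ dir G u v /\ ~~ bid G u v)].

Definition Root G : {set T} := [set v in verts G | children G v == set0].

Definition connects (s : mgraph T) X Y Z G : Prop :=
  [/\ subgraph s G,
      exists2 x, x \in X & x \in verts s,
      exists2 y, y \in Y & y \in verts s,
      Root s \subset Z :|: X :|: Y &
      forall v, v \in verts s -> v \notin Root s -> v \notin Z].

End MixedGraphs.

(* Cluster-DAG.  A node c stands for the cluster {c_1, ..., c_(csize c)}. *)
Record cluster_dag := ClusterDAG {
  cnode : finType;
  csize : cnode -> nat;
  csize_gt0 : forall c, 0 < csize c;
  cgraph : mgraph cnode;
  cgraph_verts : verts cgraph = [set: cnode]
}.

Section ClusterDAG.
Variable GC : cluster_dag.

Local Notation cdir := (dir (cgraph GC)).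
Local Notation cbid := (bid (cgraph GC)).

(* Indices start at 0: the variable V_i is Tagged _ (i - 1), with tag V. *)
Definition micro : finType := {c : cnode GC & 'I_(csize c)}.

Definition micro_set (S : {set cnode GC}) : {set micro} :=
  [set v : micro | tag v \in S].

Definition compatible (Gm : mgraph micro) : Prop :=
  [/\ admg Gm,
      verts Gm = [set: micro],
      forall a b, a != b ->
        (cdir a b <-> exists u v : micro, [/\ tag u = a, tag v = b & dir Gm u v]) /\
        (cbid a b <-> exists u v : micro, [/\ tag u = a, tag v = b & bid Gm u v]) &
      forall a,
        (cdir a a <-> exists u v : micro,
            [/\ tag u = a, tag v = a, u != v & dir Gm u v]) /\
        (cbid a a <-> exists u v : micro,
            [/\ tag u = a, tag v = a, u != v & bid Gm u v])].

Definition admissible : Prop := exists Gm, compatible Gm.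

Definition min_dir : rel micro := [rel u v : micro |
  cdir (tag u) (tag v) &&
  (if tag u == tag v then (tagged u < tagged v)%N
   else (tagged u == 0 :> nat) && (tagged v == (csize (tag v)).-1 :> nat))].

Definition min_bid : rel micro := [rel u v : micro |
  cbid (tag u) (tag v) && (u != v)].

Fact in_setTT (e : rel micro) x y :
  e x y -> (x \in [set: micro]) && (y \in [set: micro]).
Proof. by rewrite !in_setT. Qed.

Fact min_bid_sym : symmetric min_bid.
Proof. by move=> u v; rewrite /min_bid /= bid_sym eq_sym. Qed.

Definition min_graph : mgraph micro :=
  MGraph (@in_setTT min_dir) (@in_setTT min_bid) min_bid_sym.

Definition to_choose : rel micro := [rel u v : micro |
  cdir (tag u) (tag v) &&
  acyclicb [rel x y | min_dir x y || (x == u) && (y == v)]].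

Definition unfolded_dir : rel micro := [rel u v | min_dir u v || to_choose u v].

Definition unfolded : mgraph micro :=
  MGraph (@in_setTT unfolded_dir) (@in_setTT min_bid) min_bid_sym.

End ClusterDAG.

(* Main.v *)
Require Import Defs.
From mathcomp Require Import all_boot.

Set Implicit Arguments.
Unset Strict Implicit.
Unset Printing Implicit Defensive.

(** Both properties amount to plain connectedness in one auxiliary graph.  Given
    a mixed graph [G], call [Z], [X] and [Y] terminals and let [core G] consist
    of the vertices with a directed path to a terminal whose vertices before
    its end lie outside [Z], with the edges of [G] between them except the
    arrows out of [Z].  Then [X] and [Y] are not d-separated by [Z] in [G] if and
    only if some [x] in [X] and some [y] in [Y] are connected in [core G]
    ([dsep_coreP]).  An active path lies in the core.  Conversely, along a
    connection in the core an interior non-collider has a child, hence is not in [Z];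
    a collider is either an ancestor of [Z], or an ancestor of [X] or [Y] away
    from [Z], and then the walk can start or end at that other vertex
    ([core_reach]); loops can be cut out of active walks
    ([reach_active_path]).

    A connecting structure lies in the core, because its vertices run down to
    its roots ([structure_core_connect]).  Conversely a connection in the core
    can be pruned to a structure of interest without creating roots
    ([prune_connected], [core_connect_structure]): as long as a vertex has too
    many arrows, edges can be deleted.

    It remains to compare micro graphs with the unfolded graph.  If a structure
    in the unfolded graph forms no directed cycle with the minimal graph, their
    union is a compatible micro graph ([compatible_between]), and it contains
    the structure.  In the other direction, the variables of each cluster of a
    compatible graph can be renamed, without leaving the cluster, so that their
    indices follow a topological order.  Then this graph and the minimal one
    both lie in the graph of all the edges that the cluster-DAG and this order
    permit, which is acyclic and lies in the unfolded graph
    ([compatible_order_graph], [order_graph_unfolded]).  Renaming within clusters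
    respects sets of clusters, so it carries the core of one mutilated graph
    into the core of the other. *)

(** * Acyclic relations *)

Section AcyclicRelations.
Variable T : finType.
Implicit Types e : rel T.

Lemma sub_acyclic e e' : subrel e e' -> acyclic e' -> acyclic e.
Proof.
move=> ee' /acyclicP/forallP ac; apply/acyclicP/forallP => x.
apply/forallP => y; apply/implyP => /ee' exy; apply/negP => yx.
have /negP[] := implyP (forallP (ac x) y) exy.
by apply: connect_sub yx => a b /ee'; apply: connect1.
Qed.

Lemma ranked_acyclic e (rank : T -> nat) :
  (forall x y, e x y -> rank x < rank y) -> acyclic e.
Proof.
move=> lt_rank; apply/acyclicP/forallP => x; apply/forallP => y.
apply/implyP => /lt_rank ltxy; apply/negP => /connectP[p yp xE].
suff: rank y <= rank x by rewrite leqNgt ltxy.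
rewrite xE; elim: p y yp {xE ltxy} => [|z p IHp] y //= /andP[yz zp].
exact: leq_trans (ltnW (lt_rank _ _ yz)) (IHp _ zp).
Qed.

Lemma acyclic_descendants e x y : acyclic e -> e x y ->
  #|connect e y| < #|connect e x|.
Proof.
move=> /acyclicP/forallP/(_ x)/forallP/(_ y)/implyP ac exy.
apply: proper_card; apply/properP; split.
  by apply/subsetP => z; apply: connect_trans; apply: connect1.
by exists x; [apply: connect0 | apply: ac].
Qed.

Lemma acyclic_rank e : acyclic e ->
  exists2 rank : T -> nat, injective rank & forall x y, e x y -> rank x < rank y.
Proof.
(* Mixed radix: the enumeration rank only breaks ties. *)
move=> ac; exists (fun x => (#|T| - #|connect e x|) * #|T| + enum_rank x) => [x y|x y exy].
  move=> eq_xy; apply/enum_rank_inj/val_inj => /=.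
  by have /(congr1 (modn^~ #|T|)) := eq_xy; rewrite !modnMDl !modn_small.
have lt_xy := acyclic_descendants ac exy.
have le_x : #|connect e x| <= #|T| by apply: max_card.
apply: leq_trans (leq_addr _ _).
apply: leq_trans (leq_mul (ltn_sub2l (leq_trans lt_xy le_x) lt_xy) (leqnn _)).
by rewrite mulSn addnC ltn_add2r.
Qed.

End AcyclicRelations.

(** * Subgraphs and connectedness *)

Section Subgraphs.
Variable T : finType.
Implicit Types (G H s : mgraph T) (x y u v w : T).

Lemma adjacentE G x y : adjacent G x y = [|| dir G x y, dir G y x | bid G x y].
Proof. by []. Qed.

Lemma adjacent_sym G : symmetric (adjacent G).
Proof. by move=> x y; rewrite !adjacentE bid_sym orbCA. Qed.

Lemma connect_adjacent_sym G : connect_sym (adjacent G).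
Proof. exact/sym_connect_sym/adjacent_sym. Qed.

Lemma adjacent_verts G x y :
  adjacent G x y -> (x \in verts G) && (y \in verts G).
Proof. by case/or3P => [/dir_verts|/dir_verts/andP[-> ->]|/bid_verts]. Qed.

Lemma subgraph_trans G H s : subgraph s H -> subgraph H G -> subgraph s G.
Proof.
move=> [sV sd sb] [HV Hd Hb]; split; first exact: subset_trans HV.
  by move=> x y /sd/Hd.
by move=> x y /sb/Hb.
Qed.

Lemma subgraph_admg G H : subgraph H G -> admg G -> admg H.
Proof.
move=> [_ sd sb] [ac irrd irrb]; split; first exact: sub_acyclic sd ac.
  by move=> x; apply/negP => /sd; rewrite irrd.
by move=> x; apply/negP => /sb; rewrite irrb.
Qed.

Lemma subgraph_adjacent G H : subgraph H G -> subrel (adjacent H) (adjacent G).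
Proof.
by move=> [_ sd sb] x y /or3P[/sd|/sd|/sb] h; rewrite adjacentE h ?orbT.
Qed.

Lemma subgraph_connect G H : subgraph H G ->
  subrel (connect (adjacent H)) (connect (adjacent G)).
Proof. by move=> /subgraph_adjacent sHG; apply: connect_sub => x y /sHG; apply: connect1. Qed.

Lemma one_component_connect G x y :
  n_comp (adjacent G) (verts G) = 1 -> x \in verts G -> y \in verts G ->
  connect (adjacent G) x y.
Proof.
move=> one xG yG; have symG := connect_adjacent_sym G.
have clG : closed (adjacent G) (mem (verts G)).
  by move=> a b /adjacent_verts/andP[-> ->].
have rootG z : z \in verts G -> root (adjacent G) z \in predI (roots (adjacent G)) (mem (verts G)).
  by move=> zG; rewrite !inE roots_root //= -(closed_connect clG (connect_root _ z)).
move: one; rewrite /n_comp_mem => /eqP/card1P[r rE].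
apply/(rootP symG); have := rootG x xG; have := rootG y yG.
by rewrite !rE => /eqP-> /eqP->.
Qed.

Section Component.
Variables (G : mgraph T) (x : T).

Fact component_dir_verts u v : dir G u v && connect (adjacent G) x u ->
  (u \in [set w in verts G | connect (adjacent G) x w]) &&
  (v \in [set w in verts G | connect (adjacent G) x w]).
Proof.
case/andP=> duv xu; have /andP[uG vG] := dir_verts duv; rewrite !inE uG vG xu /=.
by apply: connect_trans xu (connect1 _); rewrite adjacentE duv.
Qed.

Fact component_bid_verts u v : bid G u v && connect (adjacent G) x u ->
  (u \in [set w in verts G | connect (adjacent G) x w]) &&
  (v \in [set w in verts G | connect (adjacent G) x w]).
Proof.
case/andP=> buv xu; have /andP[uG vG] := bid_verts buv; rewrite !inE uG vG xu /=.
by apply: connect_trans xu (connect1 _); rewrite adjacentE buv !orbT.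
Qed.

Fact component_bid_sym : symmetric (fun u v => bid G u v && connect (adjacent G) x u).
Proof.
move=> u v; rewrite bid_sym; case buv: (bid G v u) => //=.
have: connect (adjacent G) u v by apply: connect1; rewrite adjacentE bid_sym buv !orbT.
by move/(same_connect_r (connect_adjacent_sym G))=> ->.
Qed.

Definition component : mgraph T :=
  MGraph component_dir_verts component_bid_verts component_bid_sym.

Lemma component_subgraph : subgraph component G.
Proof. by split=> [|u v /andP[]|u v /andP[]] //; apply/subsetP=> u; rewrite inE => /andP[]. Qed.

Lemma component_connect u : connect (adjacent G) x u -> connect (adjacent component) x u.
Proof.
case/connectP=> p xp ->; elim/last_ind: p xp => [|p v IHp]; first by rewrite connect0.
rewrite rcons_path last_rcons => /andP[xp adj]; apply: connect_trans (IHp xp) _.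
have xl : connect (adjacent G) x (last x p) by apply/connectP; exists p.
have xv := connect_trans xl (connect1 adj).
by apply: connect1; move: adj; rewrite !adjacentE /= xl xv !andbT.
Qed.

Lemma component_one : x \in verts G -> n_comp (adjacent component) (verts component) = 1.
Proof.
move=> xG; rewrite -(n_comp_connect (connect_adjacent_sym component) x).
apply: eq_n_comp_r => u; rewrite !inE; apply/andP/idP => [[_ /component_connect]//|xu].
split; last exact: (subgraph_connect component_subgraph).
case/connectP: xu => p; case/lastP: p => [_ ->//|p v].
rewrite rcons_path last_rcons => /andP[_ /adjacent_verts/andP[_ /= vc]] ->.
by move: vc; rewrite inE => /andP[].
Qed.

End Component.

(** [H] keeps enough edges of [G] for a vertex of [H] with a child in [G] to
    have one in [H]: pruning [G] to [H] creates no root. *)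
Definition root_preserving H G : Prop := subgraph H G /\ Root H \subset Root G.

Lemma root_preserving_trans G H s :
  root_preserving s H -> root_preserving H G -> root_preserving s G.
Proof.
move=> [sH rH] [HG rG]; split; first exact: subgraph_trans sH HG.
exact: subset_trans rH rG.
Qed.

Lemma root_preservingI G H : subgraph H G ->
    (forall u w, u \in verts H -> dir G u w -> exists w', dir H u w') ->
  root_preserving H G.
Proof.
move=> HG keep; split=> //; apply/subsetP => u; rewrite !inE => /andP[uH /eqP noH].
have [/subsetP-> //= _ _] := HG; apply: contraT => /set0Pn[w]; rewrite inE.
by case/(keep u w uH)=> w' uw'; have := in_set0 w'; rewrite -noH inE uw'.
Qed.

End Subgraphs.

(** * Pruning a connected graph to a structure of interest *)

Section Pruning.
Variable T : finType.
Implicit Types (G H : mgraph T) (x y u v w : T).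

Definition edge_count G := #|[set p | dir G p.1 p.2]| + #|[set p | bid G p.1 p.2]|.

Lemma subgraph_edge_count G H : subgraph H G -> edge_count H <= edge_count G.
Proof.
move=> [_ sd sb].
by apply: leq_add; apply/subset_leq_card/subsetP => p; rewrite !inE; [apply: sd | apply: sb].
Qed.

Lemma edge_count_dir G H u v : subgraph H G -> dir G u v -> ~~ dir H u v ->
  edge_count H < edge_count G.
Proof.
move=> [_ sd sb] uvG uvH; rewrite /edge_count -addSn; apply: leq_add; last first.
  by apply/subset_leq_card/subsetP => p; rewrite !inE => /sb.
apply/proper_card/properP; split; first by apply/subsetP=> p; rewrite !inE => /sd.
by exists (u, v); rewrite inE.
Qed.

Lemma edge_count_bid G H u v : subgraph H G -> bid G u v -> ~~ bid H u v ->
  edge_count H < edge_count G.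
Proof.
move=> [_ sd sb] uvG uvH; rewrite /edge_count -addnS; apply: leq_add.
  by apply/subset_leq_card/subsetP => p; rewrite !inE => /sd.
apply/proper_card/properP; split; first by apply/subsetP=> p; rewrite !inE => /sb.
by exists (u, v); rewrite inE.
Qed.

Section DeleteArrow.
Variables (G : mgraph T) (v w : T).

Fact delete_arrow_verts a b : dir G a b && ((a, b) != (v, w)) ->
  (a \in verts G) && (b \in verts G).
Proof. by case/andP=> /dir_verts. Qed.

Definition delete_arrow : mgraph T :=
  MGraph delete_arrow_verts (@bid_verts _ G) (@bid_sym _ G).

Lemma delete_arrow_subgraph : subgraph delete_arrow G.
Proof. by split=> // a b /= /andP[]. Qed.

Lemma delete_arrow_adjacent a b :
  (a, b) != (v, w) -> (b, a) != (v, w) ->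
  adjacent delete_arrow a b = adjacent G a b.
Proof. by move=> ab ba; rewrite !adjacentE /= ab ba !andbT. Qed.

End DeleteArrow.

Definition avoiding G v : rel T :=
  [rel a b | [&& adjacent G a b, a != v & b != v]].

Lemma avoiding_sym G v : symmetric (avoiding G v).
Proof. by move=> a b; rewrite /avoiding /= adjacent_sym [(_ != _) && _]andbC. Qed.

Lemma path_avoiding G v x p :
  path (adjacent G) x p -> v \notin x :: p -> connect (avoiding G v) x (last x p).
Proof.
elim: p x => [|a p IHp] x /=; first by rewrite connect0.
case/andP=> xa ap; rewrite inE negb_or eq_sym => /andP[xv vap].
apply: connect_trans (IHp a ap vap); apply: connect1.
by move: vap; rewrite inE negb_or eq_sym => /andP[av _]; rewrite /avoiding /= xa xv av.
Qed.

Lemma connect_avoiding_delete G v w a b :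
  connect (avoiding G v) a b -> connect (adjacent (delete_arrow G v w)) a b.
Proof.
apply: connect_sub => c d /and3P[cd cv dv]; apply: connect1.
by rewrite delete_arrow_adjacent // xpair_eqE negb_and ?cv ?dv.
Qed.

Lemma delete_arrow_other G v w a : a != v -> a != w -> adjacent G a v ->
  connect (adjacent (delete_arrow G v w)) a v.
Proof.
move=> av aw adj; apply: connect1.
by rewrite delete_arrow_adjacent // xpair_eqE negb_and ?av ?aw ?orbT.
Qed.

(** A path from [x] to [y] survives the deletion of an arrow [v -> w] unless
    it runs along it, and a simple path leaves [v] on at most two sides.  If
    every arrow out of [v] is a bridge, the children of [v] are therefore
    exactly its two neighbours on the path. *)
Lemma bridging_children G x y v :
    irreflexive (dir G) -> connect (adjacent G) x y -> 1 < #|children G v| ->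
    (forall w, dir G v w -> ~~ connect (adjacent (delete_arrow G v w)) x y) ->
  exists a b, [/\ children G v = [set a; b], a != b,
                  connect (avoiding G v) x a & connect (avoiding G v) b y].
Proof.
move=> irr /connectP[p0 xp0 yE] two sep.
have dirN w : dir G v w -> w != v by apply: contraTneq => ->; rewrite irr.
case/card_gt1P: two => w1 [w2 []]; rewrite !inE => vw1 vw2 w12.
have not1 z : ~ (forall w, dir G v w -> w = z).
  by move=> sub1; move: w12; rewrite (sub1 _ vw1) (sub1 _ vw2) eqxx.
move: yE; case/shortenP: xp0 => p xp uniq_p _ {p0} yE.
have [vp|vNp] := boolP (v \in x :: p); last first.
  case/negP: (sep w1 vw1); rewrite yE.
  exact/connect_avoiding_delete/path_avoiding.
have toL w a : dir G v w -> w != a -> adjacent G a v -> a != v ->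
    connect (adjacent (delete_arrow G v w)) a v.
  by move=> vw wa av aNv; apply: delete_arrow_other; rewrite // eq_sym.
have toR w a : dir G v w -> w != a -> adjacent G v a -> a != v ->
    connect (adjacent (delete_arrow G v w)) v a.
  by move=> vw wa va aNv; rewrite connect_adjacent_sym toL // adjacent_sym.
have suffix_ok q : v \notin q -> path (adjacent G) v q -> last v q != v ->
    exists2 b, adjacent G v b & connect (avoiding G v) b (last v q) /\ b != v.
  case: q => [|b q] /=; first by rewrite eqxx.
  rewrite inE negb_or eq_sym => /andP[bv vq] /andP[vb bq] _.
  by exists b => //; split=> //; apply: path_avoiding; rewrite // inE negb_or eq_sym bv.
case/splitPl: vp xp uniq_p yE => p1 p2 lastv.
rewrite cat_path lastv last_cat lastv -cat_cons cat_uniq => /andP[xp1 vp2].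
case/and3P=> uniq1 /hasPn disj _ yE.
have vNp2 : v \notin p2 by apply/negP => /disj; rewrite /= -lastv mem_last.
have left_part : x != v -> exists2 a, adjacent G a v & connect (avoiding G v) x a /\ a != v.
  case/lastP: p1 => [|p1 z] in lastv xp1 uniq1 {disj} *; first by rewrite -lastv eqxx.
  move: lastv xp1 uniq1; rewrite last_rcons => -> /[!rcons_path] /andP[xp1 av].
  rewrite -rcons_cons rcons_uniq => /andP[vp1 _] _; exists (last x p1) => //; split.
    exact: path_avoiding.
  by apply: contraNneq vp1 => <-; apply: mem_last.
have [xv|xNv] := eqVneq x v.
  have [yv|yNv] := eqVneq y v.
    by case/negP: (sep w1 vw1); rewrite xv yv connect0.
  have [|b vb [by_ bv]] := suffix_ok p2 vNp2 vp2; first by rewrite -yE.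
  case: (not1 b) => w vw; apply/eqP/negPn/negP => wb; case/negP: (sep w vw).
  rewrite xv yE; apply: connect_trans (connect_avoiding_delete _ by_).
  exact: toR.
have [a av [xa aNv]] := left_part xNv.
have [yv|yNv] := eqVneq y v.
  case: (not1 a) => w vw; apply/eqP/negPn/negP => wa; case/negP: (sep w vw).
  by rewrite yv; apply: connect_trans (connect_avoiding_delete _ xa) _; apply: toL.
have [|b vb [by_ bv]] := suffix_ok p2 vNp2 vp2; first by rewrite -yE.
rewrite -yE in by_.
have sub w : dir G v w -> (w == a) || (w == b).
  move=> vw; apply: contraT; rewrite negb_or => /andP[wa wb].
  case/negP: (sep w vw); apply: connect_trans (connect_avoiding_delete _ xa) _.
  apply: connect_trans (toL _ _ vw wa av aNv) _.
  by apply: connect_trans (toR _ _ vw wb vb bv) _; apply: connect_avoiding_delete.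
have [va vb'] : dir G v a /\ dir G v b.
  have := sub _ vw1; have := sub _ vw2.
  case/orP=> /eqP w2E; case/orP=> /eqP w1E; rewrite w1E w2E in vw1 vw2 w12 * => //;
    by rewrite eqxx in w12.
exists a, b; split=> //; last first.
  by apply/eqP => ab; apply: (not1 a) => w /sub; rewrite -ab orbb => /eqP.
by apply/setP=> w; rewrite !inE; apply/idP/idP => [/sub//|/orP[]/eqP->].
Qed.

(** When every arrow out of [v] is a bridge between [x] and [y], no arrowhead
    at [v] is needed to join [x] to [y]; and a vertex that loses its arrow into
    [v] by the deletion of these arrowheads is no longer connected to [x], as
    that arrow would otherwise bypass one of the two bridges. *)
Lemma bridging_mutilate G x y v (G' := mutilate G [set v] set0) :
    irreflexive (dir G) -> connect (adjacent G) x y -> 1 < #|children G v| ->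
    (forall w, dir G v w -> ~~ connect (adjacent (delete_arrow G v w)) x y) ->
  [/\ #|children G v| = 2, connect (adjacent G') x y &
      forall u, connect (adjacent G') x u -> ~~ dir G u v].
Proof.
move=> irr xy two sep.
have [a [b [chE ab xa by_]]] := bridging_children irr xy two sep.
have chP w : dir G v w = (w == a) || (w == b).
  by move/setP/(_ w): chE; rewrite !inE.
have va : dir G v a by rewrite chP eqxx.
have vb : dir G v b by rewrite chP eqxx orbT.
have dirN w : dir G v w -> w != v by apply: contraTneq => ->; rewrite irr.
have va' : adjacent G' v a by rewrite adjacentE /= va !inE dirN.
have vb' : adjacent G' v b by rewrite adjacentE /= vb !inE dirN.
have avG' c d : connect (avoiding G v) c d -> connect (adjacent G') c d.
  apply: connect_sub => {}c {}d /and3P[cd cv dv]; apply: connect1.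
  by move: cd; rewrite !adjacentE /= !inE cv dv !andbT.
split; first by rewrite chE cards2 ab.
  apply: connect_trans (avG' _ _ xa) _; apply: connect_trans (avG' _ _ by_).
  apply: connect_trans (connect1 vb'); apply: connect1.
  by rewrite adjacent_sym.
pose side u := [|| u == v, connect (avoiding G v) a u | connect (avoiding G v) b u].
have sideS c d : adjacent G' c d -> side c -> side d.
  rewrite /side; have [->|dv] := eqVneq d v => //.
  have [-> vd _|cv cd /=] := eqVneq c v.
    move: vd; rewrite adjacentE /= !inE eqxx /= !andbF !orbF dv !andbT chP.
    by case/orP=> /eqP->; rewrite connect0 ?orbT.
  have: avoiding G v c d.
    move: cd; rewrite /avoiding /= cv dv !andbT !adjacentE /=.
    by case/or3P=> /and3P[-> _ _]; rewrite ?orbT.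
  by move/connect1=> cd' /orP[] h; rewrite (connect_trans h cd') ?orbT.
move=> u; case/connectP=> p xp ->; apply/negP => uv.
set u' := last x p in uv.
have uNv : u' != v by apply: contraTneq uv => ->; rewrite irr.
have: side u'.
  have: side x by rewrite /side (sym_connect_sym (@avoiding_sym G v)) xa orbT.
  by elim: p x xp @u' {xy xa sep uv uNv} => [|c p IHp] x //= /andP[xc /IHp H] /(sideS _ _ xc).
rewrite /side (negPf uNv) /=.
have adj_uv : adjacent G u' v by rewrite adjacentE uv.
have del w : dir G v w -> connect (adjacent (delete_arrow G v w)) u' v.
  by move=> vw; apply: connect1; rewrite adjacentE /= uv xpair_eqE (negPf uNv).
have toL w c : dir G v c -> c != w -> connect (adjacent (delete_arrow G v w)) v c.
  move=> vc cw; rewrite connect_adjacent_sym; apply: delete_arrow_other; rewrite ?dirN //.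
  by rewrite adjacentE vc orbT.
case/orP=> [au|bu].
  case/negP: (sep a va); apply: connect_trans (connect_avoiding_delete _ xa) _.
  apply: connect_trans (connect_avoiding_delete _ au) _; apply: connect_trans (del _ va) _.
  by apply: connect_trans (connect_avoiding_delete _ by_); apply: toL; rewrite // eq_sym.
case/negP: (sep b vb); apply: connect_trans (connect_avoiding_delete _ xa) _.
have va_b := toL b a va ab; have u_v := del b vb.
rewrite connect_adjacent_sym in va_b; rewrite connect_adjacent_sym in u_v.
apply: connect_trans va_b _; apply: connect_trans u_v _.
apply: connect_trans (connect_avoiding_delete _ by_); rewrite connect_adjacent_sym.
exact: connect_avoiding_delete.
Qed.

Definition degree_condition G : Prop :=
  forall v, v \in verts G ->
    #|children G v| <= 1 \/
    #|children G v| = 2 /\ (forall u, ~~ dir G u v /\ ~~ bid G u v).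

(** Induction on the number of edges.  At a vertex that violates the degree
    condition, either an arrow out of it can be deleted without separating [x]
    from [y], and the vertex keeps another child; or all these arrows are bridges, and
    the arrowheads at the vertex can be deleted together with everything that
    they alone tie to [x]. *)
Lemma prune_connected G x y :
    irreflexive (dir G) -> x \in verts G -> connect (adjacent G) x y ->
  exists H, [/\ root_preserving H G, x \in verts H, y \in verts H,
                n_comp (adjacent H) (verts H) = 1 & degree_condition H].
Proof.
have [n] := ubnP (edge_count G); elim: n G => // n IHn G ltGn irr xG xy.
pose K := component G x.
have KG : subgraph K G by apply: component_subgraph.
have xK : x \in verts K by rewrite inE xG connect0.
have yK : y \in verts K.
  rewrite inE xy andbT; case/connectP: xy => p; case/lastP: p => [_ ->//|p v].
  by rewrite rcons_path last_rcons => /andP[_ /adjacent_verts/andP[_ ?]] ->.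
pose bad v := (v \in verts K) && ~~ ((#|children K v| <= 1) ||
   (#|children K v| == 2) && [forall u, ~~ dir K u v && ~~ bid K u v]).
have [/existsP[v /andP[vK bad_v]]|/existsPn good] := boolP [exists v, bad v]; last first.
  exists K; split=> //; last 1 first.
  - move=> v vK; have := good v; rewrite /bad vK negbK => /orP[|/andP[/eqP-> /forallP inc]].
      by left.
    by right; split=> // u; apply/andP.
  - apply: root_preservingI => // u w; rewrite inE => /andP[_ xu] uw.
    by exists w; rewrite /= uw.
  - exact: component_one.
have [vG xv] : v \in verts G /\ connect (adjacent G) x v.
  by move: vK; rewrite inE => /andP.
have chK : children K v = children G v.
  by apply/setP => w; rewrite !inE /= xv andbT.
have reduce H : root_preserving H G -> edge_count H < edge_count G ->
    x \in verts H -> connect (adjacent H) x y ->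
    exists H, [/\ root_preserving H G, x \in verts H, y \in verts H,
                n_comp (adjacent H) (verts H) = 1 & degree_condition H].
  move=> HG ltHG xH xyH.
  have irrH : irreflexive (dir H).
    by have [[_ sd _] _] := HG => u; apply/negP => /sd; rewrite irr.
  have [F [FH xF yF oneF degF]] := IHn H (leq_trans ltHG ltGn) irrH xH xyH.
  by exists F; split=> //; apply: root_preserving_trans FH HG.
move: bad_v; rewrite chK negb_or -ltnNge => /andP[two bad_v].
have [/existsP[w /andP[vw xyw]]|/existsPn sep] :=
    boolP [exists w, dir G v w && connect (adjacent (delete_arrow G v w)) x y].
  apply: (reduce (delete_arrow G v w)) => //.
    apply: root_preservingI; first exact: delete_arrow_subgraph.
    move=> u c _ uc; have [uv|uv] := eqVneq u v; last first.
      by exists c; rewrite /= uc xpair_eqE (negPf uv).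
    have: exists2 c', c' \in children G v & c' != w.
      case/card_gt1P: two => w1 [w2 [w1c w2c w12]].
      have [w1w|] := eqVneq w1 w; last by exists w1.
      by exists w2; rewrite // -w1w eq_sym.
    by case=> c'; rewrite inE => vc' c'w; exists c'; rewrite uv /= vc' xpair_eqE eqxx.
  apply: edge_count_dir vw _; first exact: delete_arrow_subgraph.
  by rewrite /= eqxx andbF.
have {}sep w : dir G v w -> ~~ connect (adjacent (delete_arrow G v w)) x y.
  by move=> vw; have := sep w; rewrite vw.
have [ch2 xyM noarrow] := bridging_mutilate irr xy two sep.
pose M := mutilate G [set v] set0.
have MG : subgraph M G by split=> // a b /= /and3P[].
have CM : subgraph (component M x) M by apply: component_subgraph.
apply: (reduce (component M x)).
- apply: root_preservingI; first exact: subgraph_trans CM MG.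
  move=> u w; rewrite inE => /andP[_ xu] uw; exists w; rewrite /= xu uw !inE /= !andbT.
  by apply: contraTneq uw => ->; apply: noarrow.
- apply: leq_ltn_trans (subgraph_edge_count CM) _.
  move: bad_v; rewrite ch2 eqxx /= => /forallPn[u].
  rewrite negb_and !negbK /= => /orP[/andP[uv _]|/andP[uv _]].
    by apply: edge_count_dir uv _; rewrite //= !inE eqxx andbF.
  by apply: edge_count_bid uv _; rewrite //= !inE eqxx !andbF.
- by rewrite inE connect0 andbT.
- exact: component_connect.
Qed.

End Pruning.

(** * d-connection as plain connectedness of a core graph *)

Section Core.
Variables (T : finType) (G : mgraph T) (X Y Z : {set T}).
Implicit Types (u v w x y z r : T) (b c : bool) (s : seq (edge_kind * T)).

Definition free_dir : rel T := [rel u v | dir G u v && (u \notin Z)].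

Definition anchored v : bool :=
  [exists r, (r \in Z :|: X :|: Y) && connect free_dir v r].

Lemma anchored_terminal v : v \in Z :|: X :|: Y -> anchored v.
Proof. by move=> vT; apply/existsP; exists v; rewrite vT connect0. Qed.

Lemma anchored_dir u v : free_dir u v -> anchored v -> anchored u.
Proof.
move=> uv /existsP[r /andP[rT vr]]; apply/existsP; exists r; rewrite rT.
exact: connect_trans (connect1 uv) vr.
Qed.

Fact core_dir_verts u v : free_dir u v && anchored v ->
  (u \in verts G :&: [set w | anchored w]) && (v \in verts G :&: [set w | anchored w]).
Proof.
case/andP=> uv av; rewrite !inE av (anchored_dir uv av).
by case/andP: uv => /dir_verts/andP[-> ->].
Qed.

Fact core_bid_verts u v : [&& bid G u v, anchored u & anchored v] ->
  (u \in verts G :&: [set w | anchored w]) && (v \in verts G :&: [set w | anchored w]).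
Proof. by case/and3P=> /bid_verts/andP[uG vG] au av; rewrite !inE uG vG au av. Qed.

Fact core_bid_sym : symmetric (fun u v => [&& bid G u v, anchored u & anchored v]).
Proof. by move=> u v; rewrite bid_sym [anchored u && _]andbC. Qed.

(** In the core, the vertices without children are terminals and the others are
    outside [Z]; and it contains every acyclic subgraph of [G] with these two
    properties.  A connecting structure is therefore a connected and thinned
    out part of it. *)
Definition core : mgraph T := MGraph core_dir_verts core_bid_verts core_bid_sym.

Lemma core_subgraph : subgraph core G.
Proof.
split; first exact: subsetIl.
  by move=> u v /= /andP[/andP[]].
by move=> u v /= /and3P[].
Qed.

Lemma core_root : Root core \subset Z :|: X :|: Y.
Proof.
apply/subsetP=> v; rewrite inE => /andP[vc /eqP/setP noch].
have: anchored v by move: vc; rewrite !inE => /andP[].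
case/existsP=> r /andP[rT /connectP[[|w p] /= vp rE]]; first by rewrite -rE.
case/andP: vp => vw wp; have := noch w; rewrite in_set0 inE => /negP[].
apply/andP; split=> //; apply/existsP; exists r; rewrite rT.
by apply/connectP; exists p.
Qed.

Lemma core_nonroot v : v \in verts core -> v \notin Root core -> v \notin Z.
Proof.
rewrite [v \in Root _]inE => -> /set0Pn[w].
by rewrite inE => /andP[/andP[]].
Qed.

Definition openedb v : bool := [exists z, (z \in Z) && connect (dir G) v z].

Lemma openedP v : reflect (opened G Z v) (openedb v).
Proof.
by apply: (iffP existsP) => [[z /andP[zZ vz]]|[z zZ vz]]; exists z; rewrite ?zZ.
Qed.

Lemma opened_dir u v : dir G u v -> openedb v -> openedb u.
Proof.
move=> uv /openedP[z zZ vz]; apply/openedP; exists z => //.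
exact: connect_trans (connect1 uv) vz.
Qed.

Lemma notin_unopened v : ~~ openedb v -> v \notin Z.
Proof. by apply: contra => vZ; apply/openedP; exists v; rewrite ?connect0. Qed.

Lemma opened_anchored v : openedb v -> anchored v.
Proof.
case/openedP=> z zZ /connectP[p vp zE]; elim: p v vp zE => [|w p IHp] v /=.
  by move=> _ <-; apply: anchored_terminal; rewrite !inE zZ.
case/andP=> vw wp zE; have [vZ|vZ] := boolP (v \in Z).
  by apply: anchored_terminal; rewrite !inE vZ.
by apply: anchored_dir (IHp w wp zE); apply/andP.
Qed.

(** A traveller at [v] remembers whether the last edge had its arrowhead at
    [v]; then [v] is a collider exactly when the edge [k] that leaves also has
    its arrowhead there.  Starting with [b = false] makes the first vertex a
    non-collider. *)
Definition passes b (k : edge_kind) v : bool :=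
  if b && head_at_start k then openedb v else v \notin Z.

Fixpoint active_walk b v s : bool :=
  if s is (k, w) :: s' then
    [&& joins G k v w, passes b k v & active_walk (head_at_end k) w s']
  else v \notin Z.

Lemma active_walkP k0 v s :
  active_walk (head_at_end k0) v s <->
  [/\ walk G v s, last v (unzip2 s) \notin Z &
      forall s1 k1 u k2 w s2, (k0, v) :: s = s1 ++ (k1, u) :: (k2, w) :: s2 ->
        if head_at_end k1 && head_at_start k2 then opened G Z u else u \notin Z].
Proof.
elim: s k0 v => [|[k w] s IHs] k0 v /=.
  by split=> [vZ|[]//]; split=> // [[|? [|? ?]]].
split=> [/and3P[-> pass /IHs[-> -> inner]]|[/andP[-> ws] lastZ inner]].
  split=> // [[|p0 s1]] k1 u k2 w' s2 /=; last by case=> _; apply: inner.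
  by case=> <- <- <- _ _; move: pass; rewrite /passes; case: ifP => _ // /openedP.
rewrite /= /passes; apply/andP; split; last first.
  apply/IHs; split=> // s1 k1 u k2 w' s2 sE; apply: (inner ((k0, v) :: s1)).
  by rewrite sE.
by have := inner [::] k0 v k w s erefl; case: ifP => _ // /openedP.
Qed.

Lemma active_walk_active x s :
  active_walk false x s <-> walk G x s /\ active G Z x s.
Proof.
split=> [/(active_walkP Bwd)[ws lastZ inner]|[ws [xZ lastZ inner]]].
  split=> //; split=> //; last first.
    by move=> s1 k1 u k2 w s2 sE; apply: (inner ((Bwd, x) :: s1)); rewrite sE.
  by case: s ws lastZ inner => //= [[k w] s] _ _ /(_ [::] Bwd x k w s erefl).
apply/(active_walkP Bwd); split=> // [[|p0 s1]] k1 u k2 w s2 /=; first by case=> <- <- _.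
by case=> _; apply: inner.
Qed.

(** Along an active walk, an arrowhead at [v] can be followed forward until it
    meets a collider, which is opened, or the end of the walk. *)
Lemma active_walk_anchored v s :
  active_walk true v s -> last v (unzip2 s) \in Y -> anchored v.
Proof.
elim: s v => [|[k w] s IHs] v /=.
  by move=> _ vY; apply: anchored_terminal; rewrite !inE vY !orbT.
case/and3P; rewrite /passes; case: k => /= vw; try by move/opened_anchored.
by move=> vZ ws /(IHs _ ws); apply: anchored_dir; apply/andP.
Qed.

Lemma active_walk_core b v s :
    (b = false -> v \notin Z) -> anchored v -> active_walk b v s ->
  last v (unzip2 s) \in Y -> connect (adjacent core) v (last v (unzip2 s)).
Proof.
elim: s b v => [|[k w] s IHs] b v /= vb av; first by rewrite connect0.
case/and3P=> vw pass ws lastY.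
have wk : head_at_end k = false -> w \notin Z.
  move=> kF; move: ws; rewrite kF; case: s {IHs lastY} => //= [[k' w'] s].
  by rewrite /passes /= => /and3P[].
have aw : anchored w.
  move: ws wk; case kE : (head_at_end k) => ws wk.
    exact: active_walk_anchored ws lastY.
  by case: k vw kE {pass} => //= wv _; apply: anchored_dir av; rewrite /free_dir /= wv wk.
apply: connect_trans (IHs _ w wk aw ws lastY); apply: connect1; rewrite adjacentE /= /free_dir /=.
move: pass wk; rewrite /passes; case: k vw {ws} => /= vw; rewrite ?andbF.
- by move=> vZ _; rewrite vw vZ aw.
- by move=> _ ->; rewrite ?vw ?av ?orbT.
- by move=> _ _; rewrite vw av aw !orbT.
Qed.

(** One move of the traveller.  Reachability for this relation is existence of
    an active walk up to the condition on its last vertex, and it is easy to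
    extend at either end. *)
Definition step : rel (T * bool) := [rel p q |
  has (fun k => [&& joins G k p.1 q.1, passes p.2 k p.1 & q.2 == head_at_end k])
      [:: Fwd; Bwd; Bidir]].

Lemma stepP p q : reflect
  (exists k, [&& joins G k p.1 q.1, passes p.2 k p.1 & q.2 == head_at_end k])
  (step p q).
Proof.
rewrite /step /= orbF; apply: (iffP or3P) => [[h|h|h]|[[] h]].
- by exists Fwd.
- by exists Bwd.
- by exists Bidir.
- exact: Or31.
- exact: Or32.
- exact: Or33.
Qed.

Lemma step_joins k b v w : joins G k v w -> passes b k v ->
  step (v, b) (w, head_at_end k).
Proof. by move=> vw pass; apply/stepP; exists k; rewrite vw pass eqxx. Qed.

Definition last_head b s : bool := last b [seq head_at_end p.1 | p <- s].

Lemma active_walk_cat b v s1 s2 : active_walk b v (s1 ++ s2) ->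
  active_walk (last_head b s1) (last v (unzip2 s1)) s2.
Proof. by elim: s1 b v => [|[k w] s1 IHs] b v //= /and3P[_ _ /IHs]. Qed.

(** A walk that arrives along an arrowhead but ends along a tail turns at a
    collider before, and the first one is a descendant of its start. *)
Lemma active_walk_turn v s1 s2 :
  active_walk true v (s1 ++ s2) -> last_head true s1 = false -> openedb v.
Proof.
elim: s1 v => [|[k w] s1 IHs] v //=; rewrite /last_head /= /passes.
case: k => //= /and3P[vw pass ws] //.
by move/(IHs w ws); apply: opened_dir.
Qed.

(** Cutting a loop at [v] out of an active walk leaves an active walk: the only
    delicate case is that [v] becomes a collider without having been one, and
    then the loop starts forward and comes back along a tail. *)
Lemma active_walk_loop b k v w s1 s2 :
    active_walk b v ((k, w) :: s1 ++ s2) -> last w (unzip2 s1) = v ->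
  active_walk b v s2.
Proof.
rewrite /= => /and3P[vw pass ws] wv; have := active_walk_cat ws; rewrite wv.
case: s2 ws => [|[k2 w2] s2] //= ws /and3P[-> pass2 ->]; rewrite andbT /=.
have turn : last_head (head_at_end k) s1 = false -> head_at_start k = false -> openedb v.
  by case: k vw ws {pass pass2} => //= vw ws lF _; apply: opened_dir vw (active_walk_turn ws lF).
move: pass pass2 turn; rewrite /passes.
by case: b (last_head _ _) (head_at_start k) (head_at_start k2) => [] [] [] [] //= _ _ ->.
Qed.

(** Prepending an edge to a simple active walk closes at most one loop, at the
    new start, and that loop can be cut out. *)
Lemma reach_active_path b c v y : y \notin Z -> connect step (v, b) (y, c) ->
  exists s, [/\ active_walk b v s, last v (unzip2 s) = y & uniq (v :: unzip2 s)].
Proof.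
move=> yZ /connectP[p]; elim: p v b => [|[w d] p IHp] v b /=.
  by move=> _ [<- _]; exists [::].
case/andP=> /stepP[k /and3P[/= vw pass /eqP dE]] wp yE; rewrite {}dE in wp yE.
have [s [ws lasts uniqs]] := IHp w _ wp yE.
have vws : active_walk b v ((k, w) :: s) by rewrite /= vw pass.
have [vs|vs] := boolP (v \in w :: unzip2 s); last first.
  by exists ((k, w) :: s); split=> //; rewrite /= vs.
have [s1 [s2 [sE wv]]] : exists s1 s2, s = s1 ++ s2 /\ last w (unzip2 s1) = v.
  case/splitPl sE : {1}(unzip2 s) / vs => [p1 p2 p1v].
  exists (take (size p1) s), (drop (size p1) s); rewrite cat_take_drop; split=> //.
  by rewrite /unzip2 map_take -/(unzip2 s) sE take_size_cat.
rewrite sE in vws uniqs lasts; exists s2; split.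
- exact: active_walk_loop vws wv.
- by move: lasts; rewrite /unzip2 map_cat last_cat -/(unzip2 s1) wv.
- move: uniqs; rewrite /unzip2 map_cat -cat_cons -/(unzip2 s1) lastI wv cat_rcons.
  by rewrite cat_uniq => /and3P[].
Qed.

Lemma reach_forward b v r : connect free_dir v r -> exists c, connect step (v, b) (r, c).
Proof.
case/connectP=> p; elim: p v b => [|w p IHp] v b /=.
  by move=> _ ->; exists b; rewrite connect0.
case/andP=> /andP[vw vZ] wp rE; have [c wr] := IHp w true wp rE; exists c.
apply: connect_trans wr; apply: connect1; apply: (@step_joins Fwd) => //.
by rewrite /passes andbF.
Qed.

Lemma reach_backward v r : r \notin Z -> connect free_dir v r ->
  connect step (r, false) (v, false).
Proof.
move=> rZ /connectP[p]; elim: p v => [|w p IHp] v /=; first by move=> _ ->; rewrite connect0.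
case/andP=> /andP[vw vZ] wp rE; apply: connect_trans (IHp w wp rE) _.
apply: connect1; apply: (@step_joins Bwd) => //; rewrite /passes /=.
by case: p wp rE {IHp} => [_ /= <-|a p /= /andP[/andP[]]].
Qed.

(** Walking through the core, the only obstacle is a collider that is not
    opened.  It is anchored at a terminal outside [Z], through vertices outside
    [Z]: when this is in [Y] the walk ends there, and when it is in [X] the walk
    restarts from there and reaches the obstacle against the arrows, as a
    non-collider. *)
Lemma core_reach x y : [disjoint X & Z] -> x \in X -> y \in Y ->
    connect (adjacent core) x y ->
  exists x' y' c, [/\ x' \in X, y' \in Y & connect step (x', false) (y', c)].
Proof.
move=> XZ xX yY /connectP[p xp yE]; rewrite {}yE in yY.
have: exists2 x', x' \in X & connect step (x', false) (x, false).
  by exists x; rewrite ?connect0.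
have: false = false -> x \notin Z by move=> _; rewrite (disjointFr XZ).
move: {1 4}false => b {xX}; elim: p x b xp yY => [|w p IHp] v b /=.
  by move=> _ vY _ [x' x'X x'v]; exists x', v, b; split.
case/andP=> adj wp lastY vb [x' x'X x'v].
have [k vw wk] : exists2 k, joins core k v w & head_at_end k = false -> w \notin Z.
  case/or3P: adj => [vw|wv|vw]; [by exists Fwd|exists Bwd|by exists Bidir] => //.
  by move=> _; case/andP: wv => /andP[].
have vwG : joins G k v w.
  by have [_ sd sb] := core_subgraph; case: (k) vw => /=; [apply: sd|apply: sd|apply: sb].
have [pass|Npass] := boolP (passes b k v).
  apply: (IHp w (head_at_end k)) => //; exists x' => //.
  exact: connect_trans x'v (connect1 (step_joins vwG pass)).
have vN : ~~ openedb v.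
  move: Npass; rewrite /passes; case: ifP => // + /negPn vZ.
  case: b vb {x'v IHp} => [_|/(_ erefl)]; last by rewrite vZ.
  by case: (k) vw => //= /andP[/andP[_ /negP]].
have vZ := notin_unopened vN.
have: anchored v.
  by case/adjacent_verts/andP: adj; rewrite !inE => /andP[].
case/existsP=> r /andP[]; rewrite !inE -orbA => /or3P[rZ|rX|rY] vr.
- case/negP: vN; apply/openedP; exists r => //.
  by apply: connect_sub vr => a d /andP[ad _]; apply: connect1.
- apply: (IHp w (head_at_end k)) => //; exists r => //.
  have rv := reach_backward (negbT (disjointFr XZ rX)) vr.
  by apply: connect_trans rv (connect1 (step_joins vwG _)).
- have [c vrc] := reach_forward b vr; exists x', r, c; split=> //.
  exact: connect_trans x'v vrc.
Qed.

Lemma dsep_coreP : [disjoint X & Z] -> [disjoint Y & Z] -> verts G = [set: T] ->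
  ~ dsep G X Y Z <->
  exists x y, [/\ x \in X, y \in Y & connect (adjacent core) x y].
Proof.
move=> XZ YZ GT; split; last first.
  case=> x [y [xX yY xy]] sep.
  have [x' [y' [c [x'X y'Y x'y']]]] := core_reach XZ xX yY xy.
  have [s [ws lasts uniqs]] := reach_active_path (negbT (disjointFr YZ y'Y)) x'y'.
  have [walk_s act] := (active_walk_active _ _).1 ws.
  apply: (sep x' s x'X _ _ act); first by rewrite lasts.
  by rewrite /mpath GT in_setT walk_s.
have [/existsP[x /existsP[y /and3P[xX yY xy]]] _|Nxy] :=
    boolP [exists x, [exists y, [&& x \in X, y \in Y & connect (adjacent core) x y]]].
  by exists x, y.
case=> x s xX lastY /and3P[_ walk_s _] act; case/negP: Nxy.
apply/existsP; exists x; apply/existsP; exists (last x (unzip2 s)); rewrite xX lastY.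
have ws := (active_walk_active x s).2 (conj walk_s act).
apply: active_walk_core ws lastY; first by rewrite (disjointFr XZ).
by apply: anchored_terminal; rewrite !inE xX orbT.
Qed.

End Core.

Lemma homo_connect (T T' : finType) (e : rel T) (e' : rel T') (f : T -> T') x y :
  (forall u v, e u v -> e' (f u) (f v)) -> connect e x y -> connect e' (f x) (f y).
Proof.
move=> homo /connectP[p xp ->]; apply/connectP; exists (map f p); last by rewrite last_map.
exact: homo_path xp.
Qed.

Lemma homo_core_connect (T T' : finType) (G : mgraph T) (G' : mgraph T')
    (X Y Z : {set T}) (X' Y' Z' : {set T'}) (f : T -> T') x y :
    (forall u v, dir G u v -> dir G' (f u) (f v)) ->
    (forall u v, bid G u v -> bid G' (f u) (f v)) ->
    (forall u, (f u \in X') = (u \in X)) -> (forall u, (f u \in Y') = (u \in Y)) ->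
    (forall u, (f u \in Z') = (u \in Z)) ->
  connect (adjacent (core G X Y Z)) x y ->
  connect (adjacent (core G' X' Y' Z')) (f x) (f y).
Proof.
move=> homo_dir homo_bid fX fY fZ.
have homo_free u v : free_dir G Z u v -> free_dir G' Z' (f u) (f v).
  by case/andP=> uv uZ; rewrite /free_dir /= homo_dir //= fZ.
have homo_anchored v : anchored G X Y Z v -> anchored G' X' Y' Z' (f v).
  case/existsP=> r /andP[rT vr]; apply/existsP; exists (f r); apply/andP; split.
    by move: rT; rewrite !inE fX fY fZ.
  exact: homo_connect homo_free vr.
apply: homo_connect => u v; rewrite !adjacentE /=.
case/or3P=> [/andP[uv av]|/andP[vu au]|/and3P[uv au av]].
- by apply/or3P/Or31/andP; split; [apply: homo_free | apply: homo_anchored].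
- by apply/or3P/Or32/andP; split; [apply: homo_free | apply: homo_anchored].
- by rewrite homo_bid ?homo_anchored ?orbT.
Qed.

(** * Connecting structures *)

Section ConnectingStructures.
Variables (T : finType) (X Y Z : {set T}).
Implicit Types (G s : mgraph T).

Lemma core_connect_structure G x y :
    admg G -> verts G = [set: T] -> x \in X -> y \in Y ->
    connect (adjacent (core G X Y Z)) x y ->
  exists s, structure_of_interest s /\ connects s X Y Z G.
Proof.
move=> admgG GT xX yY xy; set K := core G X Y Z in xy.
have KG : subgraph K G by apply: core_subgraph.
have admgK := subgraph_admg KG admgG.
have xK : x \in verts K.
  by rewrite /= GT setTI inE anchored_terminal // !inE xX orbT.
have irrK : irreflexive (dir K) by case: admgK.
have [s [[sK rootsK] xs ys ones degs]] := prune_connected irrK xK xy.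
exists s; split; first by split=> //; apply: subgraph_admg sK admgK.
split; first exact: subgraph_trans sK KG.
- by exists x.
- by exists y.
- exact: subset_trans rootsK (core_root _ _ _ _).
move=> v vs vNroot; have [/subsetP sKV sd _] := sK.
apply: (core_nonroot (sKV v vs)); rewrite inE negb_and; apply/orP; right.
move: vNroot; rewrite inE vs /= => /set0Pn[w]; rewrite inE => /sd vw.
by apply/set0Pn; exists w; rewrite inE.
Qed.

(** Each vertex of a connecting structure runs down to a root of it, which is a
    terminal, through vertices outside [Z]: the structure lies in the core. *)
Lemma structure_core_connect G s :
    structure_of_interest s -> connects s X Y Z G ->
  exists x y, [/\ x \in X, y \in Y & connect (adjacent (core G X Y Z)) x y].
Proof.
case=> [[acs _ _] ones _] [[_ sd sb] [x xX xs] [y yY ys] roots nonroots].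
exists x, y; split=> //.
have free u v : dir s u v -> free_dir G Z u v.
  move=> uv; have /andP[us _] := dir_verts uv.
  rewrite /free_dir /= sd //= nonroots // inE us /=.
  by apply/set0Pn; exists v; rewrite inE.
have anchor v : v \in verts s -> anchored G X Y Z v.
  have [n] := ubnP #|connect (dir s) v|; elim: n v => // n IHn v ltvn vs.
  have [ch0|/set0Pn[w]] := eqVneq (children s v) set0.
    by apply/anchored_terminal/(subsetP roots); rewrite inE vs ch0 eqxx.
  rewrite inE => vw; apply: anchored_dir (free _ _ vw) (IHn w _ _).
    exact: leq_trans (acyclic_descendants acs vw) _.
  by case/dir_verts/andP: vw.
apply: connect_sub (one_component_connect ones xs ys) => u v uv.
have /andP[us vs] := adjacent_verts uv; apply: connect1; move: uv.
rewrite !adjacentE /= !anchor // !andbT.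
by case/or3P=> [/free|/free|/sb] -> //; rewrite ?orbT.
Qed.

End ConnectingStructures.

(** * Micro graphs of a cluster-DAG *)

Lemma increasing_enumeration n (rank : 'I_n -> nat) : injective rank ->
  {f : 'I_n -> 'I_n | forall i j : 'I_n, i < j -> rank (f i) < rank (f j)}.
Proof.
case: n rank => [|n] rank inj_rank; first by exists id => -[].
pose s := sort (relpre rank leq) (enum 'I_n.+1).
have size_s : size s = n.+1 by rewrite size_sort size_enum_ord.
have: sorted ltn (map rank s).
  rewrite ltn_sorted_uniq_leq (map_inj_uniq inj_rank) sort_uniq enum_uniq /=.
  by rewrite sorted_map; apply: sort_sorted => i j; apply: leq_total.
move=> /(sorted_ltn_nth ltn_trans 0) lt_nth.
exists (fun i : 'I_n.+1 => nth ord0 s i) => i j ltij.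
by have := lt_nth i j; rewrite !inE !size_map !size_s !(nth_map ord0) ?size_s //; apply.
Qed.

Section Micro.
Variable GC : cluster_dag.
Local Notation micro := (micro GC).
Local Notation cdir := (dir (cgraph GC)).
Local Notation cbid := (bid (cgraph GC)).
Implicit Types (u v : micro) (rank : micro -> nat).

Lemma micro_inj u v : tag u = tag v -> tagged u = tagged v :> nat -> u = v.
Proof.
case: u v => [c i] [d j] /= cd; case: d / cd j => j /= ij.
by congr existT; apply: val_inj.
Qed.

Definition order_dir rank : rel micro :=
  [rel u v | cdir (tag u) (tag v) && (rank u < rank v)].

(** The largest micro graph on the clusters of [GC] in which [rank] is a
    topological order.  The minimal graph already has every bidirected edge
    that [GC] permits. *)
Definition order_graph rank : mgraph micro :=
  MGraph (@in_setTT GC (order_dir rank)) (@in_setTT GC (@min_bid GC)) (@min_bid_sym GC).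

Lemma order_graph_acyclic rank : acyclic (dir (order_graph rank)).
Proof. by apply: (ranked_acyclic (rank := rank)) => u v /andP[]. Qed.

Lemma order_graph_admg rank : admg (order_graph rank).
Proof.
split; first exact: order_graph_acyclic.
  by move=> u; rewrite /= /order_dir /= ltnn andbF.
by move=> u; rewrite /= /min_bid /= eqxx andbF.
Qed.

Lemma order_graph_unfolded rank :
  subrel (@min_dir GC) (order_dir rank) -> subgraph (order_graph rank) (unfolded GC).
Proof.
move=> min_order; split=> // u v uv; apply/orP; right.
have /andP[cuv _] := uv; rewrite /to_choose /= cuv /=; apply/acyclicP.
apply: sub_acyclic _ (@order_graph_acyclic rank) => a b /=.
by case/orP=> [/min_order|/andP[/eqP-> /eqP->]].
Qed.

(** The map [f] renames the variables of each cluster so that their indices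
    follow a topological order of [Gm].  The minimal graph then respects this
    order too: an arrow [U_i -> V_j] puts the first variable of [U] before the
    last one of [V]. *)
Lemma compatible_order_graph Gm : compatible Gm ->
  exists rank (f : micro -> micro),
    [/\ subrel (@min_dir GC) (order_dir rank),
        forall u, tag (f u) = tag u,
        forall u v, dir Gm u v -> dir (order_graph rank) (f u) (f v) &
        forall u v, bid Gm u v -> bid (order_graph rank) (f u) (f v)].
Proof.
case=> [[acG irrd irrb] _ inter intra].
have [r inj_r lt_r] := acyclic_rank acG.
have inj_c (c : cnode GC) : injective (fun i : 'I_(csize c) => r (Tagged _ i)).
  by move=> i j /inj_r/eqP; rewrite eq_Tagged => /eqP.
pose g c := sval (increasing_enumeration (@inj_c c)).
have gP c : forall i j : 'I_(csize c), i < j -> r (Tagged _ (g c i)) < r (Tagged _ (g c j)).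
  exact: svalP (increasing_enumeration (@inj_c c)).
pose h u : micro := Tagged _ (g (tag u) (tagged u)).
have rh u v : tag u = tag v -> tagged u < tagged v -> r (h u) < r (h v).
  by case: u v => [c i] [d j] /= cd; case: d / cd j => j; apply: gP.
have inj_h : injective h.
  move=> u v huv; have tuv : tag u = tag v by have /(congr1 tag) := huv.
  have [lt|lt|eq] := ltngtP (tagged u) (tagged v).
  - by have := rh _ _ tuv lt; rewrite huv ltnn.
  - by have := rh _ _ (esym tuv) lt; rewrite huv ltnn.
  - exact: micro_inj.
pose f := invF inj_h.
have hf u : h (f u) = u by apply: f_invF.
have tag_f u : tag (f u) = tag u by rewrite -[in RHS](hf u).
have rank_le u v : tag u = tag v -> tagged u <= tagged v -> r (h u) <= r (h v).
  move=> tuv; rewrite leq_eqVlt => /orP[/eqP eq|/(rh _ _ tuv)/ltnW//].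
  by rewrite (micro_inj tuv eq).
have cdir_tag u v : dir Gm u v -> cdir (tag u) (tag v).
  move=> uv; have [tuv|tuv] := eqVneq (tag u) (tag v).
    rewrite -tuv; apply/(intra _).1; exists u, v; split=> //.
    by apply: contraTneq uv => ->; rewrite irrd.
  by apply/(inter _ _ tuv).1; exists u, v.
have cbid_tag u v : bid Gm u v -> cbid (tag u) (tag v).
  move=> uv; have [tuv|tuv] := eqVneq (tag u) (tag v).
    rewrite -tuv; apply/(intra _).2; exists u, v; split=> //.
    by apply: contraTneq uv => ->; rewrite irrb.
  by apply/(inter _ _ tuv).2; exists u, v.
exists (r \o h), f; split=> //.
- move=> u v /andP[cuv]; rewrite /order_dir /= cuv /=.
  case: eqP => [tuv|/eqP tuv]; first exact: rh.
  case/andP=> /eqP u0 /eqP v1.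
  have [u' [v' [tu' tv' uv']]] := (inter _ _ tuv).1.1 cuv.
  have le_u : r (h u) <= r u'.
    by rewrite -(hf u') rank_le ?tag_f // u0.
  have le_v : r v' <= r (h v).
    rewrite -(hf v') rank_le ?tag_f // v1 -ltnS.
    by rewrite prednK ?csize_gt0 // -tv' -(tag_f v'); apply: ltn_ord.
  exact: leq_trans (leq_trans (le_u : r (h u) < (r u').+1) (lt_r _ _ uv')) le_v.
- by move=> u v uv; rewrite /= /order_dir /= !tag_f !hf cdir_tag ?lt_r.
- move=> u v uv; rewrite /= /min_bid /= !tag_f cbid_tag //=.
  by apply: contraTneq uv => /(congr1 h); rewrite !hf => ->; rewrite irrb.
Qed.

(** The minimal graph realises each edge of [GC], and the unfolded graph has no
    edge that [GC] does not allow.  Admissibility is what makes a cluster with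
    a self-loop large enough for the minimal graph to realise it. *)
Lemma compatible_between Gm : admissible GC ->
    subgraph (min_graph GC) Gm -> subgraph Gm (unfolded GC) ->
  acyclic (dir Gm) -> compatible Gm.
Proof.
case=> G0 [_ _ _ intra0] [minV mind minb] [_ Gd Gb] acG.
have cdir_tag u v : dir Gm u v -> cdir (tag u) (tag v).
  by move=> /Gd /orP[] /andP[].
have irrd : irreflexive (dir Gm).
  by move=> u; apply/negP => uu; have := acyclic_descendants acG uu; rewrite ltnn.
have bidE u v : bid Gm u v = cbid (tag u) (tag v) && (u != v).
  by apply/idP/idP => [/Gb|/minb].
pose first (c : cnode GC) : micro := Tagged _ (Ordinal (csize_gt0 c)).
have last_lt (c : cnode GC) : (csize c).-1 < csize c by rewrite ltn_predL csize_gt0.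
pose last (c : cnode GC) : micro := Tagged _ (Ordinal (last_lt c)).
split.
- by split=> // u; rewrite bidE eqxx andbF.
- by apply/eqP; rewrite eqEsubset subsetT.
- move=> a b ab; split; split.
  + move=> cab; exists (first a), (last b); split=> //; apply: mind.
    by rewrite /= /min_dir /= cab (negPf ab) !eqxx.
  + by case=> u [v [<- <- /cdir_tag]].
  + move=> cab; exists (first a), (last b); split=> //; rewrite bidE cab /=.
    by apply: contraNneq ab => /(congr1 tag) /= ->.
  + by case=> u [v [<- <-]]; rewrite bidE => /andP[].
- move=> a; split; split.
  + move=> caa; have [u [v [ua va uv _]]] := (intra0 a).1.1 caa.
    have lt_dir (u' v' : micro) : tag u' = a -> tag v' = a -> tagged u' < tagged v' ->
        exists u v : micro, [/\ tag u = a, tag v = a, u != v & dir Gm u v].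
      move=> ua' va' lt; exists u', v'; split=> //.
        by apply: contraTneq lt => ->; rewrite ltnn.
      apply: mind; have tuv : tag u' == tag v' by rewrite ua' va'.
      have cuv : cdir (tag u') (tag v') by rewrite ua' va'.
      by rewrite /= /min_dir /= cuv tuv.
    have [lt|lt|eq] := ltngtP (tagged u) (tagged v).
    * exact: lt_dir lt.
    * exact: lt_dir lt.
    * by move: uv; rewrite (micro_inj _ eq) ?eqxx // ua.
  + by case=> u [v [<- tv _ /cdir_tag]]; rewrite tv.
  + move=> caa; have [u [v [ua va uv _]]] := (intra0 a).2.1 caa.
    by exists u, v; split=> //; rewrite bidE ua va caa.
  + by case=> u [v [<- tv _]]; rewrite bidE tv => /andP[].
Qed.


End Micro.

Theorem theorem4 (GC : cluster_dag) (hadm : admissible GC)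
    (X Y Z A B : {set cnode GC})
    (hXY : [disjoint X & Y]) (hXZ : [disjoint X & Z]) (hYZ : [disjoint Y & Z]) :
  (exists Gm : mgraph (micro GC),
     compatible Gm /\
     ~ dsep (mutilate Gm (micro_set A) (micro_set B))
         (micro_set X) (micro_set Y) (micro_set Z))
  <->
  (exists s : mgraph (micro GC),
     [/\ structure_of_interest s,
         connects s (micro_set X) (micro_set Y) (micro_set Z)
           (mutilate (unfolded GC) (micro_set A) (micro_set B)) &
         acyclic (dir (union (min_graph GC) s))]).
Proof.
have disj (S : {set cnode GC}) : [disjoint S & Z] -> [disjoint micro_set S & micro_set Z].
  move=> SZ; rewrite disjoint_subset; apply/subsetP => u; rewrite !inE.
  by move=> uS; rewrite (disjointFr SZ uS).
split=> [[Gm [compGm]]|[s [soi conn acs]]].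
  have GmT : verts Gm = [set: micro GC] by case: compGm.
  case/dsep_coreP; rewrite ?disj //= => x [y [xX yY xy]].
  have [rank [f [min_order tag_f f_dir f_bid]]] := compatible_order_graph compGm.
  pose G := order_graph rank; pose mut H := mutilate H (micro_set A) (micro_set B).
  have fS (S : {set cnode GC}) u : (f u \in micro_set S) = (u \in micro_set S).
    by rewrite !inE tag_f.
  have admgG : admg (mut G).
    by apply: subgraph_admg (order_graph_admg rank); split=> // u v /andP[].
  have fxX : f x \in micro_set X by rewrite fS.
  have fyY : f y \in micro_set Y by rewrite fS.
  have fxy : connect (adjacent (core (mut G) (micro_set X) (micro_set Y) (micro_set Z)))
                     (f x) (f y).
    apply: homo_core_connect xy => // u v /= /and3P[].
      by move=> /f_dir /= ->; rewrite !fS => -> ->.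
    by move=> /f_bid /= ->; rewrite !fS => -> ->.
  have [s [soi [[sV sd sb] sX sY sR sN]]] := core_connect_structure admgG erefl fxX fyY fxy.
  have [_ Ud _] := order_graph_unfolded min_order.
  exists s; split=> //.
    split=> //; split=> // u v /sd /=.
    by case/and3P=> /Ud /= -> -> ->.
  apply: sub_acyclic _ (order_graph_acyclic (rank := rank)) => u v /=.
  by case/orP=> [/min_order|/sd /and3P[]].
have [[_ sd sb] sX sY sR sN] := conn.
pose Gm := union (min_graph GC) s.
have compGm : compatible Gm.
  apply: compatible_between => //.
    by split=> [|u v|u v] /=; [apply: subsetUl|move=> ->|move=> ->].
  split=> [|u v|u v] /=; first by apply/subsetP => u; rewrite inE.
    by case/orP=> [uv|/sd/and3P[]//]; apply/orP; left.
  by case/orP=> [//|/sb/and3P[]].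
exists Gm; split=> //; apply/dsep_coreP; rewrite ?disj //=.
  by rewrite setTU.
apply: (structure_core_connect soi); split=> //; split.
- by apply/subsetP=> u; rewrite /= setTU inE.
- by move=> u v uv; rewrite /= uv orbT; case/sd/and3P: uv => _ -> ->.
- by move=> u v uv; rewrite /= uv orbT; case/sb/and3P: uv => _ -> ->.
Qed.
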